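(* Let $(X,\mathscr{A},\mu,T)$ be a dynamical system, let $A$ be a finite set, let $\xi: X\to A$ be a random variable (a measurable map) and let $f: A\times A\to A$ be a function. Suppose that there exists a joining $\lambda\in J_3(T)$ with pairwise independent coordinates such that $$\xi(x_3)=f\bigl(\xi(x_1),\xi(x_2)\bigr)\quad\text{for }\lambda\text{-almost every }(x_1,x_2,x_3)\in X^3 .$$ Then either the factor of $T$ generated by $\xi$ is periodic, or this factor has entropy at least $\log 2$.
   Context: A dynamical system $(X,\mathscr{A},\mu,T)$ consists of a Lebesgue space (equivalently, a standard Borel space with a probability measure $\mu$) and an automorphism $T$ of it: $T$ is an invertible bi-measurable transformation preserving $\mu$; maps are understood up to sets of measure $0$. $J_3(T)$ is the set of self-joinings of $T$ of order 3: probability measures $\lambda$ on $X\times X\times X$, invariant under $T\times T\times T$, whose three one-dimensional marginals all equal $\mu$. The coordinates $x_1,x_2,x_3$ are pairwise independent under $\lambda$ if the marginal of $\lambda$ on any two of the three coordinates is $\mu\otimes\mu$. The factor of $T$ generated by $\xi$ is the dynamical system $(A^{\mathbb{Z}},\mu_\xi,\sigma)$, where $\sigma$ is the shift $(a_k)_{k}\mapsto(a_{k+1})_{k}$ and $\mu_\xi$ is the law of the stationary process $(\xi\circ T^k)_{k\in\mathbb{Z}}$ under $\mu$. It is periodic if there is an integer $p\ge1$ such that $\sigma^p=\mathrm{Id}$ $\mu_\xi$-almost everywhere. Its entropy is its Kolmogorov–Sinai entropy, $\lim_{m\to\infty}\frac1m H(\xi,\xi\circ T,\dots,\xi\circ T^{m-1})$,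 where $H$ is Shannon entropy (computed with the same logarithm as in $\log 2$). *)

(* Defs.v *)
From HB Require Import structures.
From mathcomp Require Import all_boot all_order all_algebra.
From mathcomp Require Import all_classical all_reals all_analysis.

Set Implicit Arguments.
Unset Strict Implicit.
Unset Printing Implicit Defensive.

Import Order.TTheory GRing.Theory Num.Theory.
Import numFieldNormedType.Exports.

Local Open Scope classical_set_scope.
Local Open Scope ring_scope.

(* [X] is isomorphic, as a measurable space, to a Polish space with its Borel
   sigma-algebra; a Hausdorff pseudometric space is a metric space. *)
Definition standard_borel (R : realType) (d : measure_display)
    (X : measurableType d) : Prop :=
  exists (Y : completePseudoMetricType R) (f : X -> Y),
    [/\ hausdorff_space Y, @second_countable Y, bijective f &
        @measurable d X = [set f @^-1` B | B in <<s @open Y >>]].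

(* Invertibility is required only almost everywhere, maps being understood up
   to null sets. That [aut_inv] preserves [mu] is a consequence. *)
Record automorphism (R : realType) (d : measure_display)
    (X : measurableType d) (mu : probability X R) := Automorphism {
  aut_fun :> X -> X ;
  aut_inv : X -> X ;
  measurable_aut : measurable_fun setT aut_fun ;
  measurable_aut_inv : measurable_fun setT aut_inv ;
  aut_preserves : forall E, measurable E -> mu (aut_fun @^-1` E) = mu E ;
  aut_funK : {ae mu, forall x, aut_inv (aut_fun x) = x} ;
  aut_invK : {ae mu, forall x, aut_fun (aut_inv x) = x} }.

Definition zpow (R : realType) (d : measure_display) (X : measurableType d)
    (mu : probability X R) (T : automorphism mu) (k : int) : X -> X :=
  match k with
  | Posz n => iter n T
  | Negz n => iter n.+1 (aut_inv T)
  end.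

Definition periodic_system (R : realType) (d : measure_display)
    (X : measurableType d) (mu : probability X R) (T : automorphism mu) : Prop :=
  exists p : nat, (0 < p)%N /\ {ae mu, forall x, iter p T x = x}.

(* Measurable maps into a finite set with its discrete sigma-algebra. *)
Record finite_rv (d : measure_display) (X : measurableType d) (A : finType) :=
  FiniteRV {
    rv_fun :> X -> A ;
    measurable_rv : forall B : set A, measurable (rv_fun @^-1` B) }.

Section joinings.
Context {R : realType} {d : measure_display} {X : measurableType d}.
Variable mu : probability X R.

Definition coord1 (w : X * X * X) : X := w.1.1.
Definition coord2 (w : X * X * X) : X := w.1.2.
Definition coord3 (w : X * X * X) : X := w.2.

Definition J3 (T : automorphism mu) : set (probability (X * X * X)%type R) :=
  [set lambda |
    (forall E, measurable E ->
       lambda [set w | E (T (coord1 w), T (coord2 w), T (coord3 w))] =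
       lambda E) /\
    (forall E : set X, measurable E ->
       [/\ lambda (coord1 @^-1` E) = mu E,
           lambda (coord2 @^-1` E) = mu E &
           lambda (coord3 @^-1` E) = mu E])].

Definition pairwise_independent (lambda : probability (X * X * X)%type R) :
    Prop :=
  forall E : set (X * X), measurable E ->
    [/\ lambda [set w | E (coord1 w, coord2 w)] = (mu \x mu)%E E,
        lambda [set w | E (coord1 w, coord3 w)] = (mu \x mu)%E E &
        lambda [set w | E (coord2 w, coord3 w)] = (mu \x mu)%E E].

End joinings.

Section factor.
Context {R : realType} {d : measure_display} {X : measurableType d}.
Context {mu : probability X R} {A : finType}.

(* Bi-infinite sequences. The argument [xi] serves only to
   exhibit a default element, which measurable types must have; [A] itself is
   not assumed to have one. *)
Definition bisequence (xi : finite_rv X A) : Type := int -> A.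

HB.instance Definition _ xi := Choice.on (bisequence xi).
HB.instance Definition _ xi :=
  isPointed.Build (bisequence xi) (fun=> xi point).

Definition cylinders (xi : finite_rv X A) : set (set (bisequence xi)) :=
  [set C | exists (k : int) (B : set A), C = [set a | B (a k)]].

Notation factor_space xi := (g_sigma_algebraType (@cylinders xi)).

Variables (T : automorphism mu) (xi : finite_rv X A).

Definition itinerary (x : X) : factor_space xi :=
  fun k => xi (zpow T k x).

Lemma measurable_zpow k : measurable_fun setT (zpow T k).
Proof.
have mi (g : X -> X) n :
    measurable_fun setT g -> measurable_fun setT (iter n g).
  move=> mg; elim: n => [|n IH]; first exact: measurable_id.
  exact: (measurableT_comp mg IH).
by case: k => n; apply: mi; [exact: measurable_aut|exact: measurable_aut_inv].
Qed.

Lemma measurable_to_factor_space d' (Z : measurableType d')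
    (g : Z -> factor_space xi) :
  (forall k (B : set A), measurable [set z | B (g z k)]) ->
  measurable_fun setT g.
Proof.
move=> H.
refine (@measurability _ _ _ _ setT g (@cylinders xi) erefl _).
by move=> _ [_ [k [B ->]] <-]; rewrite setTI; exact: H.
Qed.

Lemma measurable_itinerary : measurable_fun setT itinerary.
Proof.
apply: measurable_to_factor_space => k B.
rewrite -[X in measurable X]setTI.
exact: (measurable_zpow k measurableT (measurable_rv xi B)).
Qed.

HB.instance Definition _ :=
  isMeasurableFun.Build _ _ _ _ itinerary measurable_itinerary.

Definition factor_law : probability (factor_space xi) R :=
  distribution mu itinerary.

Definition seq_shift (a : factor_space xi) : factor_space xi :=
  fun k => a (k + 1).
Definition seq_shift_inv (a : factor_space xi) : factor_space xi :=
  fun k => a (k - 1).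

Lemma measurable_coordinate k (B : set A) :
  measurable [set a : factor_space xi | B (a k)].
Proof. by apply: sub_sigma_algebra; exists k, B. Qed.

Lemma measurable_shift : measurable_fun setT seq_shift.
Proof.
by apply: measurable_to_factor_space => k B; exact: measurable_coordinate.
Qed.

Lemma measurable_shift_inv : measurable_fun setT seq_shift_inv.
Proof.
by apply: measurable_to_factor_space => k B; exact: measurable_coordinate.
Qed.

Lemma shift_itinerary x :
  aut_inv T (T x) = x -> seq_shift (itinerary x) = itinerary (T x).
Proof.
move=> Tx; apply/funext => -[n|[|n]]; rewrite /seq_shift /itinerary.
- by rewrite -PoszD addn1 /zpow iterSr.
- by rewrite [zpow T _ (T x)]/= Tx NegzE addNr.
- rewrite [zpow T (Negz n.+1)]/zpow iterSr Tx.
  suff -> : Negz n.+1 + 1 = Negz n by [].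
  by rewrite !NegzE -addn1 PoszD opprD addrNK.
Qed.

Lemma shift_preserves E :
  measurable E -> factor_law (seq_shift @^-1` E) = factor_law E.
Proof.
move=> mE; rewrite /factor_law /distribution /pushforward /=.
have mP F : measurable F -> measurable (itinerary @^-1` F).
  by move=> mF; rewrite -[X in measurable X]setTI; exact: measurable_itinerary.
have mTP F : measurable F -> measurable (T @^-1` F).
  by move=> mF; rewrite -[X in measurable X]setTI; exact: (measurable_aut T).
have mS : measurable (seq_shift @^-1` E).
  by rewrite -[X in measurable X]setTI; exact: measurable_shift.
rewrite -[RHS](aut_preserves T); last exact: mP.
have [N [mN N0 TN]] := aut_funK T.
have le_ae (F G : set X) : measurable F -> measurable G ->
    (forall x, aut_inv T (T x) = x -> F x -> G x) -> (mu F <= mu G)%E.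
  move=> mF mG FG; rewrite -[leRHS]adde0 -N0.
  apply: le_trans (measureU2 _ mG mN); apply: le_measure; rewrite ?inE//.
    exact: measurableU.
  move=> x Fx; have [Tx|nTx] := pselect (aut_inv T (T x) = x).
    by left; exact: FG.
  by right; exact: TN.
apply/eqP; rewrite eq_le; apply/andP; split; apply: le_ae;
  try (by apply: mP); try (by apply: mTP; apply: mP);
  by move=> x Tx /=; rewrite shift_itinerary.
Qed.

Lemma shiftK : {ae factor_law, forall a, seq_shift_inv (seq_shift a) = a}.
Proof.
by apply: aeW => a; apply/funext => k; rewrite /seq_shift_inv /seq_shift subrK.
Qed.

Lemma shift_invK : {ae factor_law, forall a, seq_shift (seq_shift_inv a) = a}.
Proof.
by apply: aeW => a; apply/funext => k; rewrite /seq_shift_inv /seq_shift addrK.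
Qed.

Definition factor_shift : automorphism factor_law :=
  Automorphism measurable_shift measurable_shift_inv shift_preserves
    shiftK shift_invK.

End factor.

Definition shannon_entropy (R : realType) (d : measure_display)
    (X : measurableType d) (mu : probability X R) (B : finType) (Z : X -> B) :
    R :=
  let p b := fine (mu (Z @^-1` [set b])) in
  - \sum_(b : B) p b * ln (p b).

Definition block (R : realType) (d : measure_display) (X : measurableType d)
    (mu : probability X R) (A : finType) (T : automorphism mu)
    (xi : finite_rv X A) (m : nat) (x : X) : m.-tuple A :=
  [tuple xi (iter i T x) | i < m].

(* The entropy of the factor is that of the time-zero generating partition; the
   finite-dimensional laws of [factor_law T xi] are those of the blocks of [xi]
   under [mu]. The value at [m = 0] does not affect the limit. *)
Definition factor_entropy (R : realType) (d : measure_display)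
    (X : measurableType d) (mu : probability X R) (A : finType)
    (T : automorphism mu) (xi : finite_rv X A) : R :=
  limn (fun m : nat => shannon_entropy mu (block T xi m) / m%:R).

(* Main.v *)
Require Import Defs.
From HB Require Import structures.
From mathcomp Require Import all_boot all_order all_algebra all_fingroup.
From mathcomp Require Import all_classical all_reals all_analysis.

(** The joining forces every block of the process to be uniformly distributed
    on its support. Write Z for the block of length m of [xi]. Because [lambda]
    is invariant, Z at the third coordinate is a function F of Z at the first
    two, namely [f] applied letter by letter. Let p be the law of Z, and let b
    and c have positive probability. By independence of coordinates 2 and 3,
    the event Z(x2) = b, Z(x3) = c has positive probability, so some block a
    with p(a) > 0 satisfies F(a, b) = c. By independence of coordinates 1 and 2,
    and then of 1 and 3,
      p(a) p(b) = lambda(Z1 = a, Z2 = b) <= lambda(Z1 = a, Z3 = c) = p(a) p(c),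
    hence p(b) <= p(c) ([joining_flat]). By symmetry p is constant on its
    support.

    What remains is counting. Let s(m) be the number of words of length m with
    positive probability. Uniformity for two consecutive lengths makes the
    number of one-letter extensions of a word the same for all words of length
    m, on the right as well as on the left, and equal to s(m+1)/s(m)
    ([card_extensions]). These integer ratios do not increase with m, since
    every letter that may follow a word may follow its suffixes
    ([word_count_ratio]). Two cases are left.

    - Some ratio is 1. Then each window of length m determines both the next
      and the previous one, so the passage to the next window is a permutation
      of a finite set; its order is a period of the process
      ([window_permutation], [stable_periodic]).
    - All ratios are at least 2. The entropy of a block of length m is ln s(m),
      the sum of the logarithms of the first m ratios; by the lemma of Cesaro
      the entropy of the factor is the limit of these logarithms, and is at
      least ln 2 ([growth_rate]). *)

Import Order.TTheory GRing.Theory Num.Theory.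
Import numFieldNormedType.Exports.

Local Open Scope classical_set_scope.
Local Open Scope ring_scope.

Set Implicit Arguments.
Unset Strict Implicit.
Unset Printing Implicit Defensive.

(** * Finite partitions and almost sure statements *)

Lemma measure_partition (R : realType) (d : measure_display)
    (X : measurableType d) (mu : {measure set X -> \bar R}) (B : finType)
    (Z : X -> B) (E : set X) :
  (forall b, measurable (Z @^-1` [set b])) -> measurable E ->
  mu E = (\sum_(b : B) mu (E `&` Z @^-1` [set b]))%E.
Proof.
move=> mZ mE; rewrite fsbig_seq ?index_enum_uniq//.
have -> : [set` index_enum B] = [set: B].
  by apply/seteqP; split=> b //= _; rewrite mem_index_enum.
rewrite -(measure_fin_bigcup mu finite_finset).
- congr (mu _); apply/seteqP; split=> [x Ex|x [b _ []]//].
  by exists (Z x).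
- by move=> b c _ _ [x [[_ /= <-] [_ /= <-]]].
- by move=> b _; exact: measurableI.
Qed.

Lemma ae_preserved (R : realType) (d : measure_display) (X : measurableType d)
    (mu : {measure set X -> \bar R}) (g : X -> X) (P : X -> Prop) :
  measurable_fun setT g ->
  (forall E, measurable E -> mu (g @^-1` E) = mu E) ->
  {ae mu, forall x, P x} -> {ae mu, forall x, P (g x)}.
Proof.
move=> mg mug [N [mN N0 PN]]; exists (g @^-1` N); split.
- by rewrite -[X in measurable X]setTI; exact: mg.
- by rewrite mug.
- by move=> x nPx; exact: PN.
Qed.

Lemma ae_iter (R : realType) (d : measure_display) (X : measurableType d)
    (mu : {measure set X -> \bar R}) (g : X -> X) (P : X -> Prop) :
  measurable_fun setT g ->
  (forall E, measurable E -> mu (g @^-1` E) = mu E) ->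
  {ae mu, forall x, P x} -> {ae mu, forall x, forall n, P (iter n g x)}.
Proof.
move=> mg mug Px; apply/ae_foralln; elim=> [//|n IH].
have := ae_preserved mg mug IH.
by apply: filterS => x; rewrite -iterSr.
Qed.

Lemma measure_le_ae (R : realType) (d : measure_display) (X : measurableType d)
    (mu : {measure set X -> \bar R}) (E F : set X) :
  measurable E -> measurable F -> {ae mu, forall x, E x -> F x} ->
  (mu E <= mu F)%E.
Proof.
move=> mE mF [N [mN N0 EFN]]; rewrite -[leRHS]adde0 -N0.
apply: le_trans (measureU2 _ mF mN); apply: le_measure; rewrite ?inE//.
  exact: measurableU.
move=> x Ex; have [Fx|nFx] := pselect (F x); first by left.
by right; apply: EFN => /(_ Ex).
Qed.

(** * Uniformity of a process that is a function of two independent copies *)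

(** All three independences are used: that of coordinates 2 and 3 produces a
    value [a] with [F a b = c], and the other two compare the masses of [b] and
    [c] through the common factor [mu (Z = a)]. Exchanging [b] and [c] turns the
    inequality into an equality. *)
Lemma joining_flat (R : realType) (d : measure_display) (X : measurableType d)
    (mu : probability X R) (lambda : probability (X * X * X)%type R) (B : finType)
    (Z : X -> B) (F : B -> B -> B) :
  (forall b, measurable (Z @^-1` [set b])) ->
  pairwise_independent mu lambda ->
  {ae lambda, forall w, Z (coord3 w) = F (Z (coord1 w)) (Z (coord2 w))} ->
  forall b c, (0 < mu (Z @^-1` [set b]))%E -> (0 < mu (Z @^-1` [set c]))%E ->
  (mu (Z @^-1` [set b]) <= mu (Z @^-1` [set c]))%E.
Proof.
move=> mZ ind ZF b c pb pc.
set p := fun b => mu (Z @^-1` [set b]).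
have mcoord (g : X * X * X -> X) e : measurable_fun setT g ->
    measurable ((Z \o g) @^-1` [set e]).
  by move=> mg; rewrite -[X in measurable X]setTI; exact: (mg measurableT _ (mZ e)).
have m1 e := mcoord _ e (measurableT_comp measurable_fst measurable_fst).
have m2 e := mcoord _ e (measurableT_comp measurable_snd measurable_fst).
have m3 e := mcoord _ e (measurable_snd).
pose E1 e := [set w : X * X * X | Z (coord1 w) = e].
pose E2 e := [set w : X * X * X | Z (coord2 w) = e].
pose E3 e := [set w : X * X * X | Z (coord3 w) = e].
have l12 e e' : lambda (E1 e `&` E2 e') = (p e * p e')%E.
  rewrite -product_measure1E//.
  by have [<- _ _] := ind _ (measurableX (mZ e) (mZ e')).
have l13 e e' : lambda (E1 e `&` E3 e') = (p e * p e')%E.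
  rewrite -product_measure1E//.
  by have [_ <- _] := ind _ (measurableX (mZ e) (mZ e')).
have l23 e e' : lambda (E2 e `&` E3 e') = (p e * p e')%E.
  rewrite -product_measure1E//.
  by have [_ _ <-] := ind _ (measurableX (mZ e) (mZ e')).
(* Disintegrate the event of positive mass over the value at coordinate 1. *)
have [a la] : exists a, lambda (E2 b `&` E3 c `&` E1 a) != 0%E.
  apply: contrapT => /forallNP H.
  have : (0 < lambda (E2 b `&` E3 c))%E by rewrite l23 mule_gt0.
  rewrite (@measure_partition _ _ _ lambda _ (Z \o coord1)) //; last first.
    by apply: measurableI; [exact: m2|exact: m3].
  rewrite big1 ?ltxx// => a _.
  by apply/eqP/negPn/negP/H.
have Fab : F a b = c.
  apply: contrapT => Fab; move/eqP: la; apply; apply/eqP; rewrite -measure_le0.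
  rewrite -(measure0 lambda); apply: measure_le_ae => //.
    by apply: measurableI; [apply: measurableI; [exact: m2|exact: m3]|exact: m1].
  apply: filterS ZF => w /= Zw [[]]; rewrite /E1 /E2 /E3/= => w2 w3 w1.
  by apply: Fab; rewrite -w1 -w2 -w3.
have pab : (p a * p b <= p a * p c)%E.
  rewrite -l12 -l13; apply: measure_le_ae.
  - by apply: measurableI; [exact: m1|exact: m2].
  - by apply: measurableI; [exact: m1|exact: m3].
  by apply: filterS ZF => w /= Zw [w1 w2]; split=> //; rewrite /E3/= Zw w1 w2.
have pa : (0 < p a)%E.
  rewrite lt0e measure_ge0 andbT; apply: contra la => /eqP pa0.
  rewrite -measure_le0 -(mul0e (p b)) -pa0 -l12; apply: le_measure; rewrite ?inE.
  - by apply: measurableI; [apply: measurableI; [exact: m2|exact: m3]|exact: m1].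
  - by apply: measurableI; [exact: m1|exact: m2].
  - by move=> w [[]].
by move: pab; rewrite lee_pmul2l// fin_num_measure.
Qed.

(** * Counting the words of a stationary process with uniform blocks *)

(** The laws of all blocks of a stationary process, seen as one function [q] on
    words: [law_rcons] and [law_cons] express consistency and stationarity, and
    [law_flat] says that the blocks of each length are uniform on their
    support. *)
Record flat_stationary_law (R : realType) (A : finType) (q : seq A -> R) :
    Prop := FlatStationaryLaw {
  law_ge0 : forall w, 0 <= q w ;
  law_total : forall m, \sum_(w : m.-tuple A) q w = 1 ;
  law_rcons : forall w, \sum_(a : A) q (rcons w a) = q w ;
  law_cons : forall w, \sum_(a : A) q (a :: w) = q w ;
  law_flat : forall v w, size v = size w -> 0 < q v -> 0 < q w -> q v = q w }.

Section word_counting.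
Context {R : realType} {A : finType} {q : seq A -> R}.
Context (hq : flat_stationary_law q).

Definition word_count (r : seq A -> R) (m : nat) : nat :=
  #|[set w : m.-tuple A | 0 < r w]%SET|.

Definition extension_count (r : seq A -> R) (g : A -> seq A) : nat :=
  #|[set a | 0 < r (g a)]%SET|.

Lemma sum_flat (B : finType) (g : B -> seq A) (w : seq A) :
  (forall b, size (g b) = size w) -> 0 < q w ->
  \sum_(b : B) q (g b) = q w * (#|[set b | 0 < q (g b)]%SET|%:R).
Proof.
move=> sg qw; rewrite mulr_natr -sumr_const.
rewrite [RHS]big_mkcond /=; apply: eq_bigr => b _; rewrite inE.
case: ifPn => [qb|]; first exact: (law_flat hq).
rewrite -leNgt => qb; apply/eqP; rewrite eq_le qb/=; exact: (law_ge0 hq).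
Qed.

Lemma law_word_count w : 0 < q w -> q w * (word_count q (size w))%:R = 1.
Proof.
move=> qw; have := @sum_flat _ (fun v : (size w).-tuple A => tval v) w.
by rewrite (law_total hq) => <- // v; exact: size_tuple.
Qed.

Lemma exists_positive (B : finType) (g : B -> seq A) :
  0 < \sum_(b : B) q (g b) -> exists b, 0 < q (g b).
Proof.
move=> h; apply: contrapT => /forallNP H; move: h.
rewrite ltNge => /negP; apply; apply: sumr_le0 => b _.
by rewrite leNgt; apply/negP/H.
Qed.

Lemma word_count_gt0 m : (0 < word_count q m)%N.
Proof.
have [|w qw] := @exists_positive (m.-tuple A) val; first by rewrite (law_total hq).
by apply/card_gt0P; exists w; rewrite inE.
Qed.

Lemma exists_word m : exists w : m.-tuple A, 0 < q w.
Proof.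
by have /card_gt0P[w] := word_count_gt0 m; rewrite inE => qw; exists w.
Qed.

(** Both families of extensions, on the right and on the left, are instances of
    [g]. The mass of [w] is 1/s(m), and it is shared among extensions which all
    have mass 1/s(m+1). *)
Lemma card_extensions (g : A -> seq A) (w : seq A) :
  (forall a, size (g a) = (size w).+1) -> \sum_a q (g a) = q w -> 0 < q w ->
  (extension_count q g * word_count q (size w))%N =
  word_count q (size w).+1.
Proof.
move=> sg sumg qw.
have [a qa] : exists a : A, 0 < q (g a).
  by apply: exists_positive; rewrite sumg.
have := law_word_count qw.
rewrite -sumg (@sum_flat _ g (g a)) ?sg//.
rewrite -[RHS](law_word_count qa) sg -mulrA => /(mulfI (lt0r_neq0 qa)).
by rewrite -natrM => /eqP; rewrite eqr_nat => /eqP.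
Qed.

Lemma card_rcons w : 0 < q w ->
  (extension_count q (rcons w) * word_count q (size w))%N =
  word_count q (size w).+1.
Proof.
by apply: card_extensions; [move=> a; rewrite size_rcons|exact: (law_rcons hq)].
Qed.

Lemma card_cons w : 0 < q w ->
  (extension_count q (cons^~ w) * word_count q (size w))%N =
  word_count q (size w).+1.
Proof. by apply: card_extensions => //; exact: (law_cons hq). Qed.

Lemma exists_rcons w : 0 < q w -> exists a, 0 < q (rcons w a).
Proof. by move=> qw; apply: exists_positive; rewrite (law_rcons hq). Qed.

Lemma law_cons_gt0 a w : 0 < q (a :: w) -> 0 < q w.
Proof.
move=> qaw; rewrite -(law_cons hq) (lt_le_trans qaw)// (bigD1 a)//= lerDl.
by apply: sumr_ge0 => b _; exact: (law_ge0 hq).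
Qed.

(** The ratios s(m+1)/s(m) do not increase: a letter that may follow the word
    [a :: w] may also follow [w]. *)
Lemma word_count_ratio m :
  (word_count q m.+2 * word_count q m <= word_count q m.+1 * word_count q m.+1)%N.
Proof.
have [[w /= /eqP sw] /= qw] := exists_word m.+1.
case: w => [//|a w] in sw qw *.
have {}sw : size w = m by case: sw.
rewrite -sw -(card_rcons qw) -mulnA mulnCA mulnC -(card_rcons (law_cons_gt0 qw)).
rewrite leq_mul2r; apply/orP; right; rewrite leq_mul2r; apply/orP; right.
apply: subset_leq_card; apply/fintype.subsetP => b; rewrite !inE rcons_cons.
exact: law_cons_gt0.
Qed.

(** The ratio s(m+1)/s(m) counts extensions, so it is a positive integer; this
    gap between 1 and 2 is the source of the alternative. *)
Lemma word_count_growth m :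
  word_count q m.+1 = word_count q m \/
  (2 * word_count q m <= word_count q m.+1)%N.
Proof.
have [w qw] := exists_word m; have := card_rcons qw; rewrite size_tuple => <-.
set n := extension_count _ _; have : (0 < n)%N.
  by have [a qa] := exists_rcons qw; apply/card_gt0P; exists a; rewrite inE.
case: n => [//|[|n]] _; first by left; rewrite mul1n.
by right; rewrite leq_mul2r orbT.
Qed.

Lemma word_count_stable m : word_count q m.+1 = word_count q m ->
  word_count q m.+2 = word_count q m.+1.
Proof.
move=> e; have := word_count_ratio m.
have [//|h] := word_count_growth m.+1.
rewrite e leq_pmul2r ?word_count_gt0// => h'.
move: (leq_trans h h'); rewrite e leqNgt => /negP[].
by rewrite ltn_Pmull// word_count_gt0.
Qed.

Lemma unique_extension (g : A -> seq A) (s : nat) (a b : A) : (0 < s)%N ->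
  (extension_count q g * s)%N = s ->
  0 < q (g a) -> 0 < q (g b) -> a = b.
Proof.
move=> s0 /eqP; rewrite -{2}[s]mul1n eqn_pmul2r// => /eqP c1 qa qb.
have /card_le1_eqP : (extension_count q g <= 1)%N by rewrite c1.
by apply; rewrite inE.
Qed.

(** When s(m+2) = s(m+1), a window of length m+1 has a unique continuation on
    each side, so moving the window by one letter is a bijection of the windows
    of positive mass. Extending it by the identity gives a permutation of a
    finite type, whose order is then available. Windows of length m+1 rather
    than m are used so that a window always has a first letter. *)
Lemma window_permutation m : word_count q m.+2 = word_count q m.+1 ->
  exists g : {perm m.+1.-tuple A}, forall (w v : m.+1.-tuple A) a b u,
    tval w = a :: u -> tval v = rcons u b -> 0 < q (a :: rcons u b) -> g w = v.
Proof.
move=> e.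
have extr (w : m.+1.-tuple A) a b :
    0 < q w -> 0 < q (rcons w a) -> 0 < q (rcons w b) -> a = b.
  move=> qw; apply: (unique_extension (g := rcons w) (word_count_gt0 m.+1)).
  by have := card_rcons qw; rewrite size_tuple e.
have extl (w : m.+1.-tuple A) a b :
    0 < q w -> 0 < q (a :: w) -> 0 < q (b :: w) -> a = b.
  move=> qw; apply: (unique_extension (g := cons^~ w) (word_count_gt0 m.+1)).
  by have := card_cons qw; rewrite size_tuple e.
have rcons_gt0 (w : seq A) a : 0 < q (rcons w a) -> 0 < q w.
  move=> qwa; rewrite -(law_rcons hq) (lt_le_trans qwa)// (bigD1 a)//= lerDl.
  by apply: sumr_ge0 => b _; exact: (law_ge0 hq).
(* [E w v]: [v] is [w] moved by one letter, and their union has positive mass. *)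
pose E (w v : m.+1.-tuple A) :=
  ((0 : R) < q (thead w :: v)) && (rcons w (last (thead w) v) == thead w :: v).
have Efun (w v v' : m.+1.-tuple A) : E w v -> E w v' -> v = v'.
  move=> /andP[qv /eqP ev] /andP[qv' /eqP ev'].
  rewrite -ev in qv; rewrite -ev' in qv'.
  have ll := extr _ _ _ (rcons_gt0 _ _ qv) qv qv'.
  by apply: val_inj; move: ev; rewrite ll ev' => -[].
have Einj (w w' v : m.+1.-tuple A) : E w v -> E w' v -> w = w'.
  move=> /andP[qw /eqP ew] /andP[qw' /eqP ew'].
  have tt := extl _ _ _ (law_cons_gt0 qw) qw qw'.
  apply: val_inj; move: ew'; rewrite -tt -ew => /esym.
  by move/rcons_inj => [].
have Eex (w : m.+1.-tuple A) : 0 < q w -> exists v, E w v.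
  move=> qw; have [b qb] := exists_rcons qw.
  case/tupleP: w qw qb => a u qw qb; exists [tuple of rcons u b].
  by rewrite /E theadE /= last_rcons eqxx andbT.
have Egt0 w v : E w v -> (0 < q w) /\ (0 < q v).
  move=> /andP[qv /eqP ev]; split; last exact: law_cons_gt0 qv.
  by rewrite -ev in qv; exact: rcons_gt0 qv.
pose g (w : m.+1.-tuple A) := if (0 : R) < q w then odflt w [pick v | E w v] else w.
have gE (w : m.+1.-tuple A) : 0 < q w -> E w (g w).
  move=> qw; rewrite /g qw; case: pickP => [//|no].
  by have [v] := Eex _ qw; rewrite no.
have gN (w : m.+1.-tuple A) : ~~ (0 < q w) -> g w = w by move=> /negbTE qw; rewrite /g qw.
have ginj : injective g.
  move=> w w' gg; case: (boolP (0 < q w)) => qw; case: (boolP (0 < q w')) => qw'.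
  - by apply: Einj (gE _ qw) _; rewrite gg; exact: gE.
  - by have [_] := Egt0 _ _ (gE _ qw); rewrite gg (gN _ qw') (negbTE qw').
  - by have [_] := Egt0 _ _ (gE _ qw'); rewrite -gg (gN _ qw) (negbTE qw).
  - by rewrite -(gN _ qw) -(gN _ qw').
exists (perm ginj) => w v a b u ew ev qab; rewrite permE.
have Ewv : E w v.
  rewrite /E; have -> : thead w = a.
    by have /(congr1 (fun s : seq A => head a s)) := ew; case/tupleP: (w).
  by rewrite ew ev last_rcons /= qab eqxx.
by apply: Efun (Ewv); apply: gE; have [] := Egt0 _ _ Ewv.
Qed.

Lemma word_count0 : word_count q 0 = 1%N.
Proof.
by apply/eqP; rewrite eqn_leq word_count_gt0 andbT (leq_trans (max_card _))//;
rewrite card_tuple expn0.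
Qed.

Lemma entropy_word_count m :
  - \sum_(w : m.-tuple A) q w * ln (q w) = ln (word_count q m)%:R.
Proof.
have c0 : (0 : R) < (word_count q m)%:R by rewrite ltr0n word_count_gt0.
rewrite -[RHS]mul1r -[X in _ = X * _](law_total hq m) mulr_suml -sumrN.
apply: eq_bigr => w _; have := law_ge0 hq w.
rewrite le_eqVlt => /predU1P[<-|qw]; first by rewrite !mul0r oppr0.
have -> : (word_count q m)%:R = (q w)^-1.
  have := law_word_count qw; rewrite size_tuple => h.
  by rewrite -[LHS](mulKf (lt0r_neq0 qw)) h mulr1.
by rewrite lnV ?posrE// mulrN.
Qed.

(** [ln s(m)] is the sum of the first [m] log-ratios, which do not increase and
    are bounded below by [ln 2]. They converge, so their averages converge to
    the same limit; this gives a meaning to the [limn] in the conclusion. *)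
Lemma growth_rate :
  (forall m, (2 * word_count q m <= word_count q m.+1)%N) ->
  ln 2 <= limn (fun m => ln (word_count q m)%:R / m%:R : R).
Proof.
move=> grow.
have c0 m : (0 : R) < (word_count q m)%:R by rewrite ltr0n word_count_gt0.
pose u := telescope (fun m => ln (word_count q m)%:R : R).
have uge m : ln 2 <= u m.
  rewrite /u /telescope lerBrDr -lnM ?posrE// -natrM ler_ln ?posrE ?ler_nat//.
  by rewrite natrM mulr_gt0.
have udec : nonincreasing_seq u.
  apply/nonincreasing_seqP => m; rewrite /u /telescope lerBlDr addrAC lerBrDr.
  rewrite -!lnM ?posrE// -!natrM ler_ln ?posrE ?ltr0n ?muln_gt0 ?word_count_gt0//.
  by rewrite ler_nat word_count_ratio.
have ucvg : cvgn u.
  by apply: nonincreasing_is_cvgn => //; exists (ln 2) => _ [m _ <-].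
have hcvg : (fun m => ln (word_count q m)%:R / m%:R : R) @ \oo --> limn u.
  (* The averages of the log-ratios are indexed from one term on. *)
  rewrite -cvg_shiftS /=; have := cesaro ucvg.
  rewrite /arithmetic_mean telescopeK /= word_count0 ln1.
  by apply: cvg_trans; apply: near_eq_cvg; apply: nearW => n; rewrite subr0 mulrC.
rewrite (cvg_lim _ hcvg)//; apply: limr_ge => //; exact: nearW.
Qed.

End word_counting.

(** * The words read along an orbit *)

Section itineraries.
Context {R : realType} {d : measure_display} {X : measurableType d}.
Context {mu : probability X R} {A : finType}.
Context (T : automorphism mu) (xi : finite_rv X A).

Local Notation factor_space := (g_sigma_algebraType (@cylinders _ _ _ xi)).

(** The entries of [block T xi n x] as a plain sequence, so that words are
    extended at either end without casts between tuple types. *)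
Definition word_of (n : nat) (x : X) : seq A := [seq xi y | y <- traject T x n].

Definition word_law (w : seq A) : R :=
  fine (mu [set x | word_of (size w) x = w]).

Lemma word_ofS n x : word_of n.+1 x = xi x :: word_of n (T x).
Proof. by []. Qed.

Lemma word_ofSr n x : word_of n.+1 x = rcons (word_of n x) (xi (iter n T x)).
Proof. by rewrite /word_of trajectSr map_rcons. Qed.

Lemma val_block n x : tval (block T xi n x) = word_of n x.
Proof.
apply: (@eq_from_nth _ (xi x)) => [|i]; rewrite size_tuple.
  by rewrite size_map size_traject.
move=> ni; rewrite (nth_map x) ?size_traject// nth_traject//.
by rewrite -(tnth_nth _ _ (Ordinal ni)) tnth_mktuple.
Qed.

Lemma measurable_aut_preimage E : measurable E -> measurable (T @^-1` E).
Proof.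
by move=> mE; rewrite -[X in measurable X]setTI; exact: (measurable_aut T).
Qed.

Lemma measurable_aut_iter n : measurable_fun setT (iter n T).
Proof. exact: (measurable_zpow T (Posz n)). Qed.

Lemma measurable_word n w : measurable [set x | word_of n x = w].
Proof.
elim: n w => [|n IH] [|a w].
- by rewrite [X in measurable X](_ : _ = setT)//; apply/seteqP; split.
- by rewrite [X in measurable X](_ : _ = set0)//; apply/seteqP; split.
- by rewrite [X in measurable X](_ : _ = set0)//; apply/seteqP; split.
- rewrite [X in measurable X](_ : _ =
    (xi @^-1` [set a]) `&` T @^-1` [set x | word_of n x = w]).
    apply: measurableI; first exact: measurable_rv.
    exact: measurable_aut_preimage.
  apply/seteqP; split => x /=; rewrite word_ofS; first by case=> -> ->.
  by case=> -> ->.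
Qed.

Lemma block_preimage n (w : n.-tuple A) :
  block T xi n @^-1` [set w] = [set x | word_of n x = w].
Proof.
apply/seteqP; split => x /=; rewrite -val_block; first by move->.
exact: val_inj.
Qed.

Lemma measurable_block n (w : n.-tuple A) :
  measurable (block T xi n @^-1` [set w]).
Proof. by rewrite block_preimage; exact: measurable_word. Qed.

Lemma word_law_block n (w : n.-tuple A) :
  word_law w = fine (mu (block T xi n @^-1` [set w])).
Proof. by rewrite /word_law block_preimage size_tuple. Qed.

Lemma probability_partition (B : finType) (Z : X -> B) (E : set X) :
  (forall b, measurable (Z @^-1` [set b])) -> measurable E ->
  \sum_(b : B) fine (mu (E `&` Z @^-1` [set b])) = fine (mu E).
Proof.
move=> mZ mE; apply: EFin_inj; rewrite -sumEFin fineK ?fin_num_measure//.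
rewrite (measure_partition mu mZ mE); apply: eq_bigr => b _.
by rewrite fineK// fin_num_measure//; apply: measurableI.
Qed.

Lemma block_law_total n : \sum_(w : n.-tuple A) word_law w = 1.
Proof.
transitivity (fine (mu setT)); last by rewrite probability_setT.
rewrite -(probability_partition (@measurable_block n) measurableT).
by apply: eq_bigr => w _; rewrite setTI word_law_block.
Qed.

Lemma word_law_rcons w : \sum_(a : A) word_law (rcons w a) = word_law w.
Proof.
set n := size w.
have mZ a : measurable ((xi \o iter n T) @^-1` [set a]).
  rewrite -[X in measurable X]setTI comp_preimage.
  exact: (measurable_aut_iter n measurableT (measurable_rv xi [set a])).
rewrite /word_law -(probability_partition mZ (measurable_word n w)).
apply: eq_bigr => a _.
congr (fine (mu _)); rewrite size_rcons; apply/seteqP.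
split => x /=; rewrite word_ofSr; first by move/rcons_inj=> [-> ->].
by case=> -> ->.
Qed.

(** This is where stationarity enters: the sum over the first letter is the mass
    of the event that the word is read from time 1 on. *)
Lemma word_law_cons w : \sum_(a : A) word_law (a :: w) = word_law w.
Proof.
set n := size w.
rewrite /word_law -(aut_preserves T); last exact: measurable_word.
rewrite -(@probability_partition _ xi) //; last 2 first.
- by move=> a; exact: measurable_rv.
- exact: measurable_aut_preimage (measurable_word n w).
apply: eq_bigr => a _; congr (fine (mu _)); apply/seteqP.
by split => x /=; rewrite -/n word_ofS; case=> -> ->.
Qed.

Lemma ae_word_law_gt0 :
  {ae mu, forall x, forall n i, 0 < word_law (word_of n (iter i T x))}.
Proof.
apply/ae_foralln => n.
apply: (@ae_iter _ _ _ mu T (fun x => 0 < word_law (word_of n x))).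
- exact: measurable_aut.
- exact: aut_preserves.
pose bad := [set w : n.-tuple A | ~ 0 < word_law w].
exists (\bigcup_(w in bad) block T xi n @^-1` [set w]); split.
- apply: fin_bigcup_measurable => [|w _]; first exact: finite_finset.
  exact: measurable_block.
- rewrite (measure_fin_bigcup mu finite_finset); first last.
  + by move=> w _; exact: measurable_block.
  + by move=> w v _ _ [x [/= <- <-]].
  apply: fsbig1 => w /= /negP; rewrite -leNgt word_law_block => le0.
  apply/eqP; rewrite -measure_le0 -[leLHS]fineK ?lee_fin//.
  by rewrite fin_num_measure//; exact: measurable_block.
- by move=> x /= nx; exists (block T xi n x) => //; rewrite /bad/= val_block.
Qed.

(** Periodicity of the factor bears on two-sided sequences, while the hypothesis
    compares only the letters at times 0 and [p]. The shift and its inverse both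
    preserve the law of the factor, so the comparison can be moved to every
    integer time. *)
Lemma periodic_factor p :
  (0 < p)%N -> {ae mu, forall x, xi (iter p T x) = xi x} ->
  periodic_system (factor_shift T xi).
Proof.
move=> p0 xip; exists p; split => //.
pose P (a : factor_space) := a (Posz p) = a 0.
have aeP : {ae factor_law T xi, forall a, P a}.
  (* [P] fails on a measurable set, and this is needed to pull it back to [mu]. *)
  pose N := \bigcup_(b in [set: A])
    ([set a : factor_space | [set b] (a (Posz p))] `&`
     [set a : factor_space | (~` [set b]) (a 0)]).
  have mN : measurable N.
    apply: fin_bigcup_measurable => [|b _]; first exact: finite_finset.
    by apply: measurableI; apply: measurable_coordinate.
  exists N; split => //; last first.
    by move=> a /= nPa; exists (a (Posz p)) => //; split=> //= /esym.
  have -> : factor_law T xi N = mu (itinerary T xi @^-1` N) by [].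
  apply: measure_negligible.
    by have := @measurable_itinerary _ _ _ _ _ T xi measurableT _ mN; rewrite setTI.
  apply: negligibleS xip => x [b _ [/= pb nb]] /= xp; apply: nb.
  by rewrite -pb /itinerary /= -xp.
have iter_shift n (a : factor_space) k :
    iter n (@seq_shift _ _ _ xi) a k = a (k + Posz n).
  elim: n k => [|n IH] k; first by rewrite addr0.
  by rewrite iterS /seq_shift IH -addrA -PoszD add1n.
have iter_shift_inv n (a : factor_space) k :
    iter n (@seq_shift_inv _ _ _ xi) a k = a (k - Posz n).
  elim: n k => [|n IH] k; first by rewrite subr0.
  by rewrite iterS /seq_shift_inv IH -addrA -opprD -PoszD add1n.
have inv_preserves E : measurable E ->
    factor_law T xi (@seq_shift_inv _ _ _ xi @^-1` E) = factor_law T xi E.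
  move=> mE; rewrite -shift_preserves.
    congr (factor_law T xi _); apply/seteqP.
    by split=> a /=; rewrite (_ : seq_shift_inv (seq_shift a) = a)//;
      apply/funext => k; rewrite /seq_shift_inv /seq_shift subrK.
  by have := @measurable_shift_inv _ _ _ xi measurableT _ mE; rewrite setTI.
have fwd := ae_iter (@measurable_shift _ _ _ xi)
  (@shift_preserves _ _ _ _ _ T xi) aeP.
have bwd := ae_iter (@measurable_shift_inv _ _ _ xi) inv_preserves aeP.
apply: filterS2 fwd bwd => a fwd bwd; apply/funext => k.
rewrite iter_shift; case: k => n.
  by have := fwd n; rewrite /P !iter_shift addrC add0r.
by rewrite NegzE; have := bwd n.+1; rewrite /P !iter_shift_inv addrC sub0r.
Qed.

Context (hq : flat_stationary_law word_law).

Lemma block_law_gt0 n (w : n.-tuple A) :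
  (0 < mu (block T xi n @^-1` [set w]))%E = (0 < word_law w).
Proof.
rewrite word_law_block -lte_fin fineK// fin_num_measure//.
exact: measurable_block.
Qed.

(** Almost surely all windows along the orbit have positive mass, so the window
    permutation [g] drives the sequence of windows, and the order of [g] is a
    common period. *)
Lemma stable_periodic m : word_count word_law m.+2 = word_count word_law m.+1 ->
  periodic_system (factor_shift T xi).
Proof.
move=> /(window_permutation hq)[g gP].
apply: (@periodic_factor #[g]%g); first exact: order_gt0.
apply: filterS ae_word_law_gt0 => x pos.
have step i : g (block T xi m.+1 (iter i T x)) = block T xi m.+1 (iter i.+1 T x).
  apply: (gP _ _ (xi (iter i T x)) (xi (iter m T (iter i.+1 T x)))
            (word_of m (iter i.+1 T x))).
  - by rewrite val_block.
  - by rewrite val_block word_ofSr.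
  - by rewrite -word_ofSr -word_ofS.
have : block T xi m.+1 (iter #[g]%g T x) = block T xi m.+1 x.
  rewrite -[RHS](perm1 (block T xi m.+1 x)) -(expg_order g) permX.
  by elim: #[g]%g => //= n <-; rewrite step.
by move/(congr1 val); rewrite /= !val_block !word_ofS => -[].
Qed.

Lemma factor_entropyE :
  factor_entropy T xi = limn (fun m => ln (word_count word_law m)%:R / m%:R).
Proof.
rewrite /factor_entropy; congr (limn _); apply/funext => m.
rewrite -(entropy_word_count hq); congr (- _ / _).
by apply: eq_bigr => w _; rewrite word_law_block.
Qed.

Lemma flat_dichotomy :
  periodic_system (factor_shift T xi) \/ ln 2 <= factor_entropy T xi.
Proof.
have [[m mE]|H] :=
  pselect (exists m, word_count word_law m.+1 = word_count word_law m).
  (* One more step of stability provides windows of positive length. *)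
  by left; apply: (@stable_periodic m); exact: word_count_stable.
right; rewrite factor_entropyE; apply: (growth_rate hq) => m.
by have [e|//] := word_count_growth hq m; case: H; exists m.
Qed.

End itineraries.

(** * The joining at the level of blocks *)

(** Invariance of [lambda] propagates the relation from time 0 to all times, so
    a block at coordinate 3 is a function of the blocks at coordinates 1 and
    2. *)
Lemma joining_block (R : realType) (d : measure_display) (X : measurableType d)
    (mu : probability X R) (T : automorphism mu) (A : finType)
    (xi : finite_rv X A) (f : A * A -> A)
    (lambda : probability (X * X * X)%type R) (n : nat) :
  J3 T lambda ->
  {ae lambda, forall w, xi (coord3 w) = f (xi (coord1 w), xi (coord2 w))} ->
  {ae lambda, forall w, block T xi n (coord3 w) =
    [tuple f (tnth (block T xi n (coord1 w)) i, tnth (block T xi n (coord2 w)) i)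
     | i < n]}.
Proof.
move=> [inv _] xif.
pose T3 (w : X * X * X) := (T (coord1 w), T (coord2 w), T (coord3 w)).
have mT := measurable_aut T.
have mT3 : measurable_fun setT T3.
  apply: measurable_fun_pair; [apply: measurable_fun_pair|];
    apply: (measurableT_comp mT); try exact: measurable_snd.
  - exact: (measurableT_comp measurable_fst measurable_fst).
  - exact: (measurableT_comp measurable_snd measurable_fst).
have := ae_iter mT3 inv xif; apply: filterS => w xiw.
have T3w i : iter i T3 w =
    (iter i T (coord1 w), iter i T (coord2 w), iter i T (coord3 w)).
  by elim: i => [|i IH]; [case: w {xiw} => -[]|rewrite iterS IH].
by apply: eq_from_tnth => i; rewrite !tnth_mktuple; have := xiw i; rewrite T3w.
Qed.

Theorem proposition4p6 (R : realType) (d : measure_display)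
    (X : measurableType d) (hX : standard_borel R X)
    (mu : probability X R) (T : automorphism mu)
    (A : finType) (xi : finite_rv X A) (f : A * A -> A) :
  (exists lambda : probability (X * X * X)%type R,
     [/\ J3 T lambda, pairwise_independent mu lambda &
         {ae lambda, forall w,
            xi (coord3 w) = f (xi (coord1 w), xi (coord2 w))}]) ->
  periodic_system (factor_shift T xi) \/ ln 2 <= factor_entropy T xi.
Proof.
move=> [lambda [inv ind xif]].
apply: flat_dichotomy; split.
- by move=> w; exact: fine_ge0.
- exact: block_law_total.
- exact: word_law_rcons.
- exact: word_law_cons.
have le n (v w : n.-tuple A) : 0 < word_law T xi v -> 0 < word_law T xi w ->
    word_law T xi v <= word_law T xi w.
  rewrite -!block_law_gt0 => v0 w0.
  rewrite !word_law_block fine_le ?fin_num_measure//; try exact: measurable_block.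
  pose F (v w : n.-tuple A) := [tuple f (tnth v i, tnth w i) | i < n].
  exact: (joining_flat (F := F) (@measurable_block _ _ _ _ _ T xi n) ind
    (joining_block n inv xif)).
move=> v w vw v0 w0; have /eqP vn := vw; pose v' := Tuple vn; pose w' := in_tuple w.
by apply/eqP; rewrite eq_le (le _ v' w')// (le _ w' v').
Qed.
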